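(* For every LTL$_f$ formula $\varphi$, Algorithm 2 (described below) solves the synthesis under environment specifications problem with $\mathit{Task}=\forall\varphi$ and $\mathit{Env}=\mathit{true}$: if it outputs ''Unrealisable'' then no agent strategy enforces $\forall\varphi$, and otherwise its output is a finite-state agent strategy that enforces $\forall\varphi$. Algorithm 2: let $(\mathcal D,\mathrm{safe}(T_1))=\mathrm{ConvertDA}(\forall\varphi)$, with initial state $\iota$; compute $(S_1,f)=\mathrm{Solve}_{ag}(\mathcal D,\mathrm{safe}(T_1))$; if $\iota\notin S_1$ output ''Unrealisable''; otherwise output $\mathrm{Strategy}(\mathcal D,f)$.
   Context: Fix a finite set $\mathcal P$ of atomic propositions partitioned into disjoint sets $\mathcal X$ (environment-controlled) and $\mathcal Y$ (agent-controlled); $\Sigma=2^{\mathcal P}$. LTL$_f$ formulas: $\varphi ::= p \mid \neg\varphi\mid \varphi\wedge\varphi\mid \mathsf{X}\varphi\mid \varphi\,\mathsf{U}\,\varphi$, evaluated on finite nonempty traces with standard finite-trace semantics ($\mathsf X\varphi$ holds at $i$ iff $i<|\pi|-1$ and $\varphi$ holds at $i+1$; $\varphi_1\mathsf U\varphi_2$ holds at $i$ iff $\varphi_2$ holds at some $j$ with $i\le j<|\pi|$ and $\varphi_1$ holds at all $k$ with $i\le k<j$); $\pi\models\varphi$ means $\varphi$ holds at position 0. $\exists\varphi$ is the set of infinite traces with some finite nonempty prefix satisfying $\varphi$; $\forall\varphi$ is the set of infinite traces all of whose finite nonempty prefixes satisfy $\varphi$; $\mathit{true}=\Sigma^\omega$.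 Agent strategies are $\sigma_{ag}:(2^{\mathcal X})^*\to2^{\mathcal Y}$, environment strategies $\sigma_{env}:(2^{\mathcal Y})^+\to2^{\mathcal X}$; the agent moves first: $(Y_0\cup X_0)(Y_1\cup X_1)\cdots$ follows $\sigma_{ag}$ iff $Y_0=\sigma_{ag}(\epsilon)$, $Y_{i+1}=\sigma_{ag}(X_0\cdots X_i)$, and follows $\sigma_{env}$ iff $X_i=\sigma_{env}(Y_0\cdots Y_i)$. $\sigma_{ag}$ enforces $P\subseteq\Sigma^\omega$ iff every play against any environment strategy lies in $P$; $\sigma_{ag}$ enforces $\mathit{Task}$ under $\mathit{Env}$ iff every play against any environment strategy that enforces $\mathit{Env}$ lies in $\mathit{Task}$ (with $\mathit{Env}=\mathit{true}$ this is just enforcing $\mathit{Task}$). A strategy is finite-state if computed by a finite-state transducer. Building blocks: a transition system $\mathcal D=(\Sigma,Q,\iota,\delta)$ ($Q$ finite, $\delta:Q\times\Sigma\to Q$); $\mathcal D_q$ is $\mathcal D$ with initial state $q$. For an LTL$_f$ formula $\varphi$ let $\mathcal M_\varphi=(\Sigma,Q,\iota,\delta,F)$ be a DFA accepting exactly the finite nonempty traces satisfying $\varphi$. For $T\subseteq Q$, $\mathrm{reach}(T)$ is the set of infinite runs visiting $T$ at some index $k\ge0$, $\mathrm{safe}(T)$ the set of infinite runs in $T$ at every index. $\mathrm{ConvertDA}(\exists\varphi)=((\Sigma,Q,\iota,\delta),\mathrm{reach}(F))$ and $\mathrm{ConvertDA}(\forall\varphi)=((\Sigma,Q,\iota,\delta),\mathrm{safe}(F\cup\{\iota\}))$.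 Game on $(\mathcal D,\alpha)$: an agent strategy wins from $q$ if the run of $\mathcal D_q$ on every infinite trace following it lies in $\alpha$; an environment strategy wins from $q$ if the run of $\mathcal D_q$ on every trace following it lies in $\alpha$. For $p\in\{ag,env\}$, $\mathrm{Solve}_p(\mathcal D,\alpha)$ (with $\alpha$ a reachability or safety condition) returns the winning region of $p$ (the set of states from which $p$ has a winning strategy) and a positional function $f$ (for $p=ag$, $f:Q\to2^{\mathcal Y}$) whose induced strategy wins from every state of that region. For $f:Q\to2^{\mathcal Y}$, $\mathrm{Strategy}(\mathcal D,f)$ is the agent strategy with $\sigma(\epsilon)=f(\iota)$ and $\sigma(X_0\cdots X_k)=f(q_{k+1})$, where $q_0\cdots q_{k+1}$ is the run of $\mathcal D$ on $(Y_0\cup X_0)\cdots(Y_k\cup X_k)$ and $Y_0,\dots,Y_k$ are the agent's own previous moves under $\sigma$.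
   Formalization: The DFA for φ is additionally required never to re-enter its initial state ι after a nonempty word (always achievable with a fresh initial state); otherwise safe(F∪{ι}) can exceed ∀φ and the claim fails, e.g. for φ = true U x with ι looping on ¬x. *)

(* Defs.v *)
From mathcomp Require Import all_boot.

Set Implicit Arguments.
Unset Strict Implicit.
Unset Printing Implicit Defensive.

(* The atoms P, partitioned into X (environment) and Y (agent), are the sum
   type X + Y, so that Sigma = 2^P is {set X + Y}. *)
Notation letter X Y := {set X + Y}.
Notation trace X Y := (nat -> letter X Y).
Notation lang X Y := (trace X Y -> Prop).

Definition env_part (X Y : finType) (a : letter X Y) : {set X} :=
  [set x | inl x \in a].

Definition ag_part (X Y : finType) (a : letter X Y) : {set Y} :=
  [set y | inr y \in a].

(* The letter Y_i \cup X_i. *)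
Definition join (X Y : finType) (Yi : {set Y}) (Xi : {set X}) : letter X Y :=
  (@inr X Y @: Yi) :|: (@inl X Y @: Xi).

Inductive ltlf (P : Type) : Type :=
| Atom of P
| Neg of ltlf P
| And of ltlf P & ltlf P
| Next of ltlf P
| Until of ltlf P & ltlf P.

(* Meaningful for i < size pi. *)
Fixpoint holds (P : finType) (pi : seq {set P}) (i : nat) (phi : ltlf P) : Prop :=
  match phi with
  | Atom p => p \in nth set0 pi i
  | Neg f => ~ holds pi i f
  | And f g => holds pi i f /\ holds pi i g
  | Next f => i < (size pi).-1 /\ holds pi i.+1 f
  | Until f g =>
      exists j, [/\ i <= j < size pi, holds pi j g
                  & forall k, i <= k < j -> holds pi k f]
  end.

Definition models (P : finType) (pi : seq {set P}) (phi : ltlf P) : Prop :=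
  holds pi 0 phi.

(* The property written "forall phi". *)
Definition all_prefixes (X Y : finType) (phi : ltlf (X + Y)%type) : lang X Y :=
  fun w => forall n, models (mkseq w n.+1) phi.

Definition true_lang (X Y : finType) : lang X Y := fun=> True.

Definition ag_strategy (X Y : finType) := seq {set X} -> {set Y}.

(* Only the values on nonempty histories matter. *)
Definition env_strategy (X Y : finType) := seq {set Y} -> {set X}.

Definition follows_ag (X Y : finType) (s : ag_strategy X Y) (w : trace X Y) :=
  forall i, ag_part (w i) = s (mkseq (fun j => env_part (w j)) i).

Definition follows_env (X Y : finType) (e : env_strategy X Y) (w : trace X Y) :=
  forall i, env_part (w i) = e (mkseq (fun j => ag_part (w j)) i.+1).

Definition is_play (X Y : finType) (s : ag_strategy X Y) (e : env_strategy X Y)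
    (w : trace X Y) : Prop :=
  follows_ag s w /\ follows_env e w.

Definition env_enforces (X Y : finType) (e : env_strategy X Y) (Env : lang X Y) :=
  forall s w, is_play s e w -> Env w.

Definition enforces_under (X Y : finType) (s : ag_strategy X Y)
    (Task Env : lang X Y) : Prop :=
  forall e, env_enforces e Env -> forall w, is_play s e w -> Task w.

Record transducer (X Y : finType) := Transducer {
  tr_state : finType;
  tr_init : tr_state;
  tr_step : tr_state -> {set X} -> tr_state;
  tr_out : tr_state -> {set Y}
}.

Definition finite_state (X Y : finType) (s : ag_strategy X Y) : Prop :=
  exists t : transducer X Y,
    forall h, s h = tr_out (foldl (@tr_step X Y t) (tr_init t) h).

Record tsys (X Y : finType) := TSys {
  state :> finType;
  init : state;
  delta : state -> letter X Y -> state
}.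

Definition restart (X Y : finType) (D : tsys X Y) (q : D) : tsys X Y :=
  TSys q (@delta X Y D).

Fixpoint run (X Y : finType) (D : tsys X Y) (w : trace X Y) (n : nat) : D :=
  if n is m.+1 then delta (run D w m) (w m) else init D.

Definition run_end (X Y : finType) (D : tsys X Y) (u : seq (letter X Y)) : D :=
  foldl (@delta X Y D) (init D) u.

Record dfa (X Y : finType) := DFA {
  dfa_ts :> tsys X Y;
  final : {set dfa_ts}
}.

Definition accepts (X Y : finType) (M : dfa X Y) (u : seq (letter X Y)) : bool :=
  run_end M u \in final M.

Definition recognises (X Y : finType) (M : dfa X Y) (phi : ltlf (X + Y)%type) :=
  forall u, accepts M u <-> u <> [::] /\ models u phi.

(* Normal form needed for safe(F \cup {iota}) to capture "forall phi": were iota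
   re-entered, the prefix leading back to it would be rejected by the DFA and
   yet stay in the safe set.  It is no loss of generality (no_return_wlog). *)
Definition no_return (X Y : finType) (D : tsys X Y) : Prop :=
  forall u, u <> [::] -> run_end D u <> init D.

Definition fresh_init (X Y : finType) (M : dfa X Y) : dfa X Y :=
  let step (q : option M) a := Some (delta (odflt (init M) q) a) in
  DFA (dfa_ts := TSys None step) [set Some q | q in final M].

Lemma no_return_wlog (X Y : finType) (M : dfa X Y) (phi : ltlf (X + Y)%type) :
  recognises M phi ->
  recognises (fresh_init M) phi /\ no_return (fresh_init M).
Proof.
move=> hM.
have runE a u : run_end (fresh_init M) (a :: u) = Some (run_end M (a :: u)).
  by rewrite /run_end /=; elim: u (delta _ a) => //= b u IH q; apply: IH.
split=> [[|a u]|[//|a u] _]; last by rewrite runE.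
- by split=> [/imsetP[]|[]].
- rewrite /accepts runE (mem_imset _ _ (@Some_inj _)); exact: hM.
Qed.

Inductive objective (Q : finType) : Type :=
| Reach of {set Q}
| Safe of {set Q}.

Definition in_objective (Q : finType) (alpha : objective Q) (r : nat -> Q) : Prop :=
  match alpha with
  | Reach T => exists k, r k \in T
  | Safe T => forall k, r k \in T
  end.

Definition ag_wins (X Y : finType) (D : tsys X Y) (alpha : objective D)
    (s : ag_strategy X Y) (q : D) : Prop :=
  forall w, follows_ag s w -> in_objective alpha (run (restart q) w).

(* The agent's move in the current state q is f q, so the letters read along the
   fold are the agent's own previous moves joined with the X_i (strategyE). *)
Definition strategy (X Y : finType) (D : tsys X Y) (f : D -> {set Y}) :
    ag_strategy X Y :=
  fun h => f (foldl (fun q Xi => delta q (join (f q) Xi)) (init D) h).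

Lemma strategyE (X Y : finType) (D : tsys X Y) (f : D -> {set Y}) h :
  strategy f h =
  f (run_end D (mkseq (fun i => join (strategy f (take i h)) (nth set0 h i))
                      (size h))).
Proof.
rewrite /run_end {1}/strategy; congr f.
elim/last_ind: h => [//|h x IH].
rewrite size_rcons mkseqS !foldl_rcons /= nth_rcons ltnn eqxx.
have -> : take (size h) (rcons h x) = h by rewrite -cats1 take_size_cat.
rewrite -(_ : mkseq (fun i => join (strategy f (take i h)) (nth set0 h i)) (size h)
  = mkseq (fun i => join (strategy f (take i (rcons h x))) (nth set0 (rcons h x) i))
          (size h)); first by rewrite -IH.
apply/eq_in_map => i; rewrite mem_iota add0n => /andP[_ lti].
by rewrite nth_rcons lti -cats1 takel_cat // ltnW.
Qed.

Definition ag_solver (X Y : finType) :=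
  forall D : tsys X Y, objective D -> {set D} * (D -> {set Y}).

Definition solves_ag (X Y : finType) (solve : ag_solver X Y) : Prop :=
  forall (D : tsys X Y) (alpha : objective D),
    (forall q : D, q \in (solve D alpha).1 <-> exists s, ag_wins alpha s q) /\
    (forall q : D, q \in (solve D alpha).1 ->
       ag_wins alpha (strategy (D := restart q) (solve D alpha).2) q).

Record game (X Y : finType) := Game {
  arena : tsys X Y;
  goal : objective arena
}.

(* ConvertDA(forall phi), M being the DFA chosen for phi. *)
Definition convert_all (X Y : finType) (M : dfa X Y) : game X Y :=
  Game (Safe (final M :|: [set init M])).

(* None is the output "Unrealisable". *)
Definition algorithm2 (X Y : finType) (solve : ag_solver X Y) (M : dfa X Y) :
    option (ag_strategy X Y) :=
  let G := convert_all M in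
  let: (S1, f) := solve (arena G) (goal G) in
  if init (arena G) \in S1 then Some (strategy f) else None.

Definition solves_synthesis (X Y : finType) (Task Env : lang X Y)
    (out : option (ag_strategy X Y)) : Prop :=
  match out with
  | None => ~ exists s, enforces_under s Task Env
  | Some s => finite_state s /\ enforces_under s Task Env
  end.

(* Main.v *)
Require Import Defs.
From mathcomp Require Import all_boot.

(** Against an unconstrained environment, the plays of an agent strategy are
    exactly the traces that follow it: any such trace is produced by the
    environment strategy that replays its environment moves by time alone.
    Because the DFA never returns to its initial state, a run stays in
    F \cup {iota} exactly when every nonempty prefix of the trace is accepted,
    so enforcing "forall phi" is the same as winning the safety game from iota. *)

Section Synthesis.
Variables X Y : finType.

Lemma enforces_trueP (s : ag_strategy X Y) (Task : lang X Y) :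
  enforces_under s Task (@true_lang X Y) <->
  forall w, follows_ag s w -> Task w.
Proof.
split=> [enf w sw | enf e _ w [sw _]]; last exact: enf.
(* Move [i] answers a history of length [i.+1], so the time is read off as [(size h).-1]. *)
apply: (enf (fun h => env_part (w (size h).-1))) => //.
by split=> // i; rewrite size_mkseq.
Qed.

Lemma run_restart_init (D : tsys X Y) (w : trace X Y) n :
  run (restart (init D)) w n = run D w n.
Proof. by elim: n => //= n ->. Qed.

Lemma run_endE (D : tsys X Y) (w : trace X Y) n :
  run_end D (mkseq w n) = run D w n.
Proof. by elim: n => //= n <-; rewrite mkseqS /run_end foldl_rcons. Qed.

Lemma safe_all_prefixes (M : dfa X Y) (phi : ltlf (X + Y)%type) (w : trace X Y) :
  recognises M phi -> no_return M ->
  in_objective (goal (convert_all M)) (run (restart (init M)) w) <->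
  all_prefixes phi w.
Proof.
move=> hM hinit; split=> [safe n | all_w [|n]] /=.
- have prefix_neq0 : mkseq w n.+1 <> [::] by [].
  have := safe n.+1; rewrite run_restart_init -run_endE in_setU in_set1.
  case/orP=> [acc | /eqP /(hinit _ prefix_neq0) //].
  by have [] := (hM _).1 acc.
(* At index 0 only the empty prefix has been read, which the DFA rejects: here the added initial
   state is used. *)
- by rewrite in_setU in_set1 eqxx orbT.
- have := (hM (mkseq w n.+1)).2 (conj _ (all_w n)).
  rewrite /accepts run_endE -run_restart_init => acc.
  by rewrite in_setU acc.
Qed.

Lemma ag_wins_convert_all (M : dfa X Y) (phi : ltlf (X + Y)%type)
    (s : ag_strategy X Y) :
  recognises M phi -> no_return M ->
  ag_wins (goal (convert_all M)) s (init M) <->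
  enforces_under s (all_prefixes phi) (@true_lang X Y).
Proof.
move=> hM hinit; split=> [win | /enforces_trueP enf w /enf all_w].
- by apply/enforces_trueP=> w /win /(safe_all_prefixes _ _ _ hM hinit).
- exact/(safe_all_prefixes _ _ _ hM hinit).
Qed.

(** The arena itself serves as the memory. *)
Lemma strategy_finite_state (D : tsys X Y) (f : D -> {set Y}) :
  finite_state (strategy f).
Proof.
by exists (Transducer (init D) (fun q Xi => delta q (join (f q) Xi)) f).
Qed.

End Synthesis.

Theorem theorem4 (X Y : finType) (solve_ag : ag_solver X Y)
    (hsolve : solves_ag solve_ag)
    (phi : ltlf (X + Y)%type) (M_phi : dfa X Y)
    (hM : recognises M_phi phi) (hinit : no_return M_phi) :
  solves_synthesis (all_prefixes phi) (@true_lang X Y)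
    (algorithm2 solve_ag M_phi).
Proof.
have [regionP winning] := hsolve _ (goal (convert_all M_phi)).
rewrite /algorithm2; case: (solve_ag _ _) regionP winning => S1 f /= regionP winning.
case: ifPn => [init_in | /negP init_out] /=.
- split; first exact: strategy_finite_state.
  (* Restarting the arena at its own initial state leaves [strategy f] unchanged up to
     conversion. *)
  apply/(ag_wins_convert_all _ _ _ _ _ hM hinit); exact: winning init_in.
- case=> s enf; apply: init_out; apply/regionP; exists s.
  exact/(ag_wins_convert_all _ _ _ _ _ hM hinit).
Qed.
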